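(* Let $B=\{x\in\ell_\infty : \|x\|_\infty\le 1\}$ be the closed unit ball of the real Banach space $\ell_\infty$. Then every non-expansive bijection $F\colon B\to B$ is an isometry, i.e. $\|F(x)-F(y)\|_\infty=\|x-y\|_\infty$ for all $x,y\in B$. Equivalently, the metric space $B$ (with the metric induced by the norm) is plastic.
   Context: $\ell_\infty$ is the real Banach space of all bounded real sequences $x=(x_n)_{n\in\mathbb N}$ with the norm $\|x\|_\infty=\sup_n|x_n|$. A mapping $F$ between metric spaces is called non-expansive if it is $1$-Lipschitz, i.e. $d(F(x),F(y))\le d(x,y)$ for all $x,y$. A metric space $M$ is called plastic if every non-expansive bijection $F\colon M\to M$ is an isometry. *)

(* Defs.v *)
From HB Require Import structures.
From mathcomp Require Import all_boot all_order all_algebra.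
From mathcomp Require Import all_classical all_reals all_analysis.

Set Implicit Arguments.
Unset Strict Implicit.
Unset Printing Implicit Defensive.

Import Order.TTheory GRing.Theory Num.Theory.
Import numFieldNormedType.Exports.

Local Open Scope classical_set_scope.
Local Open Scope ring_scope.

Definition bounded_seq (R : realType) : {pred nat -> R} :=
  mem [set u : nat -> R | bounded_fun u].

Record linfty (R : realType) :=
  Linfty { linfty_val :> nat -> R ; _ : linfty_val \in @bounded_seq R }.

HB.instance Definition _ (R : realType) := [isSub for @linfty_val R].
HB.instance Definition _ (R : realType) := [Choice of linfty R by <:].

Section linfty_lmodule.
Context {R : realType}.

Lemma bounded_seqP (u : nat -> R) :
  reflect (exists M, forall n, `|u n| <= M) (u \in @bounded_seq R).
Proof.
have FF : ProperFilter (globally [set: nat]).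
  exact: (@globally_properfilter _ _ 0%N).
rewrite /bounded_seq; apply: (iffP idP) => [/set_mem/ex_bound[M uM]|[M uM]].
  by exists M => n; exact: uM.
by apply/mem_set/ex_bound; exists M => n _; exact: uM.
Qed.

Lemma bounded_seq_submod_closed : submod_closed (@bounded_seq R).
Proof.
split=> [|a u v /bounded_seqP[M uM] /bounded_seqP[N vN]]; apply/bounded_seqP.
  by exists 0 => n; rewrite normr0.
exists (`|a| * M + N) => n; rewrite (le_trans (ler_normD _ _))// lerD//.
by rewrite normrM ler_wpM2l.
Qed.

HB.instance Definition _ :=
  GRing.isSubmodClosed.Build R (nat -> R) (@bounded_seq R)
    bounded_seq_submod_closed.
HB.instance Definition _ := [SubChoice_isSubLmodule of linfty R by <:].

End linfty_lmodule.

Section linfty_norm.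
Context {R : realType}.
Implicit Types x y : linfty R.

Definition sup_norm x : R := sup (range (fun n => `|x n|)).

Lemma sup_norm_has_sup x : has_sup (range (fun n => `|x n|)).
Proof.
split; first by exists `|x 0%N|; exists 0%N.
by have /bounded_seqP[M xM] := valP x; exists M => _ [n _ <-]; exact: xM.
Qed.

Lemma le_sup_norm x n : `|x n| <= sup_norm x.
Proof. by apply: (sup_upper_bound (sup_norm_has_sup x)); exists n. Qed.

Lemma sup_norm_le x (M : R) : (forall n, `|x n| <= M) -> sup_norm x <= M.
Proof.
move=> xM; apply: ge_sup; first by case: (sup_norm_has_sup x).
by move=> _ [n _ <-]; exact: xM.
Qed.

Lemma ler_sup_normD x y : sup_norm (x + y) <= sup_norm x + sup_norm y.
Proof.
apply: sup_norm_le => n.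
by rewrite (le_trans (ler_normD _ _))// lerD// le_sup_norm.
Qed.

Lemma sup_normZ (l : R) x : sup_norm (l *: x) = `|l| * sup_norm x.
Proof.
have leZ (k : R) y : sup_norm (k *: y) <= `|k| * sup_norm y.
  by apply: sup_norm_le => n; rewrite normrM ler_wpM2l// le_sup_norm.
apply/eqP; rewrite eq_le leZ/=; have [->|l0] := eqVneq l 0.
  by rewrite normr0 mul0r (le_trans _ (le_sup_norm _ 0%N)).
rewrite -ler_pdivlMl ?normr_gt0//.
by have := leZ l^-1 (l *: x); rewrite scalerK// normfV.
Qed.

Lemma sup_norm0_eq0 x : sup_norm x = 0 -> x = 0.
Proof.
move=> x0; apply/val_inj/funext => n /=; apply/eqP.
by rewrite -normr_le0 -x0 le_sup_norm.
Qed.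

HB.instance Definition _ := Lmodule_isNormed.Build R (linfty R)
  ler_sup_normD sup_normZ sup_norm0_eq0.

Lemma linfty_normE x : `|x| = sup (range (fun n => `|x n|)).
Proof. by []. Qed.

End linfty_norm.

Section linfty_complete.
Context {R : realType}.

Lemma linfty_cauchy_cvg (F : set_system (linfty R)) :
  ProperFilter F -> cauchy F -> cvg F.
Proof.
move=> FF /cauchy_ballP Fc.
have near_cauchy (e : R) : 0 < e ->
    exists2 A, F A & forall x y, A x -> A y -> `|x - y| < e.
  move=> e0; have [[P Q] [/= FP FQ] PQ] := Fc _ (divr_gt0 e0 (ltr0Sn R 1)).
  have [z [Pz Qz]] := filter_ex (filterI FP FQ).
  exists (P `&` Q) => [|x y [Px _] [Py _]]; first exact: filterI.
  have := PQ (x, z) (conj Px Qz); have := PQ (y, z) (conj Py Qz).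
  rewrite -!ball_normE/= => yz xz; rewrite [e]splitr.
  by rewrite -(subrKA z) (le_lt_trans (ler_normD _ _))// ltrD// distrC.
have coord_cvg n : cvg ((fun x : linfty R => x n) @ F).
  apply: R_complete; apply/cauchy_ballP => e e0.
  have [A FA Ae] := near_cauchy _ e0.
  pose An := [set x n | x in A].
  have FAn : F [set x | An (x n)] by apply: (filterS _ FA) => x Ax; exists x.
  exists (An, An) => //.
  move=> [_ _] /= [[x Ax <-] [y Ay <-]].
  by rewrite -ball_normE/= (le_lt_trans _ (Ae _ _ Ax Ay))//
    (le_sup_norm (x - y)).
pose l n := lim ((fun x : linfty R => x n) @ F).
have near_l (e : R) : 0 < e ->
    F [set x : linfty R | forall n, `|x n - l n| <= e].
  move=> e0; have [A FA Ae] := near_cauchy _ e0.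
  apply: (filterS _ FA) => x Ax n; apply/ler_addgt0Pr => d d0.
  have /cvgrPdist_lt/(_ _ d0)/= ld := coord_cvg n.
  have [y [Ay yd]] := filter_ex (filterI FA ld).
  rewrite -(subrKA (y n)) (le_trans (ler_normD _ _))// lerD//.
    by rewrite (le_trans (le_sup_norm (x - y) n))// ltW// Ae.
  by rewrite distrC ltW.
have lb : l \in @bounded_seq R.
  have [x xl] := filter_ex (near_l 1 ltr01).
  apply/bounded_seqP; exists (`|x| + 1) => n.
  rewrite -[l n](subrK (x n)) addrC (le_trans (ler_normD _ _))// lerD//.
    exact: le_sup_norm.
  by rewrite distrC.
apply/cvg_ex; exists (Linfty lb); apply/cvgrPdist_le => e e0.
have := near_l _ e0; apply: filterS => x xl.
by apply: sup_norm_le => n /=; rewrite distrC.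
Qed.

HB.instance Definition _ := Uniform_isComplete.Build (linfty R)
  linfty_cauchy_cvg.

(* The library derives no metricType structure from a norm. *)
Definition linfty_mdist (x y : linfty R) : R := `|x - y|.

Lemma linfty_mdist_ge0 x y : 0 <= linfty_mdist x y.
Proof. exact: normr_ge0. Qed.

Lemma linfty_mdist_positivity x y : linfty_mdist x y = 0 -> x = y.
Proof. by move=> /normr0_eq0/subr0_eq. Qed.

Lemma linfty_ballEmdist x d : ball x d = [set y | linfty_mdist x y < d].
Proof. by rewrite -ball_normE. Qed.

HB.instance Definition _ := PseudoMetric_isMetric.Build R (linfty R)
  linfty_mdist_ge0 linfty_mdist_positivity linfty_ballEmdist.

End linfty_complete.

Section set_type_metric.
Context {R : realType} {X : metricType R} (A : set X).

Definition set_type_mdist (x y : A) : R := mdist (\val x) (\val y).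

Lemma set_type_mdist_ge0 x y : 0 <= set_type_mdist x y.
Proof. exact: mdist_ge0. Qed.

Lemma set_type_mdist_positivity x y : set_type_mdist x y = 0 -> x = y.
Proof. by move=> /mdist_positivity/val_inj. Qed.

Lemma set_type_ballEmdist x d : ball x d = [set y | set_type_mdist x y < d].
Proof. by rewrite -initial_ballE set_valE ballEmdist. Qed.

HB.instance Definition _ := PseudoMetric_isMetric.Build R (A : Type)
  set_type_mdist_ge0 set_type_mdist_positivity set_type_ballEmdist.

End set_type_metric.

Definition nonexpansive (R : realType) (M N : metricType R) (F : M -> N) :=
  forall x y, mdist (F x) (F y) <= mdist x y.

Definition isometry (R : realType) (M N : metricType R) (F : M -> N) :=
  forall x y, mdist (F x) (F y) = mdist x y.

Definition plastic (R : realType) (M : metricType R) :=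
  forall F : M -> M, bijective F -> nonexpansive F -> isometry F.

Definition linfty_unit_ball (R : realType) : set (linfty R) :=
  [set x | `|x| <= 1].

Arguments linfty_unit_ball R : clear implicits.

(* Main.v *)
Require Import Defs.
From mathcomp Require Import all_boot all_order all_algebra.
From mathcomp Require Import all_classical all_reals all_analysis.
From mathcomp Require Import lra.

Import Order.TTheory GRing.Theory Num.Theory.
Import numFieldNormedType.Exports.

Local Open Scope classical_set_scope.
Local Open Scope ring_scope.

(** Let f be a non-expansive bijection of the cube [-1,1]^I with the sup metric.
    The fixed point 0 and the sign vectors are rigid enough that preimages of
    sign vectors are sign vectors and f^-1(-e) = -f^-1(e). If x = f^-1(e), a
    point whose signs agree with x is sent to a point whose signs agree with e.
    Applied to a basis vector, whose image is nonzero, this shows that every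
    coordinate of f^-1(e) is, up to a fixed sign, a fixed coordinate of e; so f^-1
    acts on sign vectors as a signed permutation T, and f o T fixes all of them.

    If f fixes all sign vectors, it keeps the sign and does not increase the
    modulus of each coordinate, and it does not decrease inf |u|. Hence it maps
    each corner cube s.[c,1]^I, 0 < c < 1, bijectively onto itself, and, rescaled
    to [-1,1]^I, this restriction again fixes all sign vectors. The corner cubes
    nearly cover the cube and are less than half its size, so the bound
    |f u - u| <= 2 improves to |f u - u| <= 2 / 2^k for every k, and f is the
    identity. *)

(** * The cube and its sign vectors *)

Definition cube (R : realType) (I : Type) : set (I -> R) :=
  [set u | forall i, `|u i| <= 1].

Definition signs (R : realType) (I : Type) : set (I -> R) :=
  [set e | forall i, e i = 1 \/ e i = -1].

(* Quantifying over the bounds d replaces the sup metric. *)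
Definition cube_nonexpansive (R : realType) (I : Type)
    (f : (I -> R) -> I -> R) : Prop :=
  forall (d : R) (u v : I -> R), cube R I u -> cube R I v ->
    (forall i, `|u i - v i| <= d) -> forall i, `|f u i - f v i| <= d.

Definition cube_contraction (R : realType) (I : Type)
    (f : (I -> R) -> I -> R) : Prop :=
  set_bij (cube R I) (cube R I) f /\ cube_nonexpansive R I f.

Definition sign_of (R : realType) (I : Type) (u : I -> R) : I -> R :=
  fun i => if 0 <= u i then 1 else -1.

Definition flip (R : realType) (I : eqType) (e : I -> R) (n : I) : I -> R :=
  fun i => if i == n then - e i else e i.

Definition axis (R : realType) (I : eqType) (m : I) (t : R) : I -> R :=
  fun i => if i == m then t else 0.

(** Supplies the continuity that the intermediate value theorem needs in [coordinate_from_inj]. *)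
Lemma nonexpansive_within_continuous (R : realType) (a b : R) (g : R -> R) :
    (forall x y, a <= x <= b -> a <= y <= b -> `|g x - g y| <= `|x - y|) ->
  {within `[a, b], continuous g}.
Proof.
move=> g_le; apply/subspace_continuousP => x /= xab.
apply/cvgrPdist_lt => e e0; rewrite near_withinE.
have := nbhsx_ballx (x : R) _ e0; rewrite -ball_normE.
apply: filterS => y xy yab; apply: le_lt_trans xy; apply: g_le.
  by move: xab; rewrite in_itv.
by move: yab; rewrite /= in_itv.
Qed.

Section cube_basics.
Context {R : realType} {I : eqType}.
Implicit Types (u v w x z e : I -> R) (i m n : I) (a c t : R).

Local Notation cube := (cube R I).
Local Notation signs := (signs R I).

Lemma cube_bounds u i : cube u -> -1 <= u i <= 1.
Proof. by move=> /(_ i); rewrite ler_norml. Qed.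

Lemma signs_cube e : signs e -> cube e.
Proof. by move=> + i => /(_ i)[]->; rewrite ?normrN normr1. Qed.

Lemma signsN e : signs e -> signs (fun i => - e i).
Proof. by move=> + i => /(_ i)[]->; rewrite ?opprK; [right|left]. Qed.

Lemma sign_of_signs u : signs (sign_of R I u).
Proof. by move=> i; rewrite /sign_of; case: ifP => _; [left|right]. Qed.

Lemma flip_signs e n : signs e -> signs (flip R I e n).
Proof.
move=> es i; rewrite /flip; case: ifP => _; last exact: es.
by case: (es i) => ->; rewrite ?opprK; [right|left].
Qed.

Lemma sign_ofP u i : 0 <= u i /\ sign_of R I u i = 1 \/
  u i < 0 /\ sign_of R I u i = -1.
Proof. by rewrite /sign_of; case: ifPn; [left|rewrite -ltNge; right]. Qed.

Lemma sub_signs_le u e : cube u -> signs e -> (forall i, 0 <= u i * e i) ->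
  forall i, `|u i - e i| <= 1.
Proof.
move=> uB es ue i; have := cube_bounds u i uB; have := ue i.
by rewrite ler_norml; case: (es i) => ->; lra.
Qed.

Lemma axis_cube m t : `|t| <= 1 -> cube (axis R I m t).
Proof. by move=> t1 i; rewrite /axis; case: ifP; rewrite ?normr0. Qed.

End cube_basics.

(** * Preimages of sign vectors *)

Section contraction.
Context {R : realType} {I : eqType} {f : (I -> R) -> I -> R}.
Hypothesis f_contr : cube_contraction R I f.
Implicit Types (u v w x z e : I -> R) (i m n : I) (a c t : R).

Local Notation cube := (cube R I).
Local Notation signs := (signs R I).

Let f_inj u v : cube u -> cube v -> f u = f v -> u = v.
Proof. by case: f_contr => -[_ fI _] _ uB vB; apply: fI; apply/mem_set. Qed.

Let f_surj u : cube u -> exists2 x, cube x & f x = u.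
Proof. by case: f_contr => -[_ _ fS] _ /fS. Qed.

Let f_le (d : R) u v : cube u -> cube v -> (forall i, `|u i - v i| <= d) ->
  forall i, - d <= f u i - f v i <= d.
Proof.
by case: f_contr => _ fN uB vB uv i; rewrite -ler_norml; exact: fN.
Qed.

Let cube0 : cube (fun=> 0).
Proof. by move=> i; rewrite normr0. Qed.

(** Each sign vector has a preimage within 1 of 0, so the image of 0 is within 1 of both constant
    vectors 1 and -1. *)
Lemma contraction0 : f (fun=> 0) = fun=> 0.
Proof.
have f0_near e : signs e -> forall i, -1 <= f (fun=> 0) i - e i <= 1.
  move=> es; have [x xB <-] := f_surj _ (signs_cube _ es).
  by apply: f_le => // i; rewrite sub0r normrN.
apply/funext => i.
have := f0_near (fun=> 1) (fun=> or_introl erefl) i.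
have := f0_near (fun=> -1) (fun=> or_intror erefl) i.
by move=> /= *; lra.
Qed.

(** The point [f w] is within [a] of 0 and within [1 - a] of [e]; in each coordinate these two
    intervals meet only at [a * e i]. *)
Lemma contraction_ray a e x w : cube x -> signs e -> f x = e -> a <= 1 ->
    cube w -> (forall i, `|w i| <= a) -> (forall i, `|w i - x i| <= 1 - a) ->
  f w = fun i => a * e i.
Proof.
move=> xB es fx a1 wB wa wx; apply/funext => i.
have := f_le a w _ wB cube0 _ i; rewrite contraction0 => /= near0.
have /near0 : forall i, `|w i - 0| <= a by move=> j; rewrite subr0.
have := f_le (1 - a) w x wB xB wx i; rewrite fx.
by case: (es i) => ->; lra.
Qed.

(* If |x n| < 1, moving x / 2 a little in direction n keeps it within 1/2 of both
   0 and x, hence does not change its image, against injectivity. *)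
Lemma preimage_signs e x : cube x -> signs e -> f x = e -> signs x.
Proof.
move=> xB es fx n; have xn := cube_bounds x n xB.
have [|x1] := eqVneq (x n) 1; first by left.
have [|x1'] := eqVneq (x n) (-1); first by right.
have {}xn : -1 < x n < 1.
  by rewrite !lt_neqAle [_ == x n]eq_sym x1 x1'.
(* The largest t for which both |t + x n / 2| and |t - x n / 2| are at most 1/2. *)
pose b := (1 - `|x n|) / 2.
have b_gt0 : 0 < b.
  by rewrite /b divr_gt0// subr_gt0 ltr_norml.
pose w t : I -> R := fun i => x i / 2 + axis R I n t i.
have w_half t : 0 <= t <= b -> f (w t) = fun i => 2^-1 * e i.
  move=> tb.
  have wle i : `|w t i| <= 2^-1 /\ `|w t i - x i| <= 1 - 2^-1.
    have xi := cube_bounds x i xB; rewrite /w /axis.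
    have [->|_] := eqVneq i n; rewrite !ler_norml; last by split; lra.
    move: tb; rewrite /b; have [x0|x0] := ger0P (x n).
      by move=> tb; split; lra.
    by move=> tb; split; lra.
  apply: (contraction_ray _ _ x) => //; last 2 first.
  - by move=> i; exact: (wle i).1.
  - by move=> i; exact: (wle i).2.
  - lra.
  - by move=> i; have := (wle i).1; lra.
have wB t : 0 <= t <= b -> cube (w t).
  move=> tb i; have xi := cube_bounds x i xB; rewrite /w /axis.
  have [->|_] := eqVneq i n; rewrite !ler_norml; last lra.
  by move: tb; rewrite /b; have [x0|x0] := ger0P (x n) => tb; lra.
have h0 : (0 : R) <= 0 <= b by lra.
have hb : 0 <= b <= b by lra.
have /(congr1 (@^~ n)) : w 0 = w b.
  by apply: f_inj; rewrite ?w_half//; exact: wB.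
by rewrite /w /axis eqxx => ?; lra.
Qed.

(* The midpoint w of x and z is at distance at most 1/2 from x / 2 and z / 2, which
   are mapped to e / 2 and - e / 2; so f w = 0 = f 0. *)
Lemma preimage_signsN e x z : cube x -> cube z -> signs e ->
  f x = e -> f z = (fun i => - e i) -> z = fun i => - x i.
Proof.
move=> xB zB es fx fz.
pose w : I -> R := fun i => (x i + z i) / 2.
have wB : cube w.
  move=> i; have := cube_bounds x i xB; have := cube_bounds z i zB.
  by rewrite /w ler_norml; lra.
have halfB u : cube u -> cube (fun i => u i / 2).
  by move=> uB i; have := cube_bounds u i uB; rewrite ler_norml; lra.
have f_half u e' : cube u -> signs e' -> f u = e' ->
    f (fun i => u i / 2) = fun i => 2^-1 * e' i.
  move=> uB es' fu; apply: (contraction_ray _ _ u) => //; first lra.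
  - exact: halfB.
  - by move=> i; have := cube_bounds u i uB; rewrite ler_norml; lra.
  - by move=> i; have := cube_bounds u i uB; rewrite ler_norml; lra.
have fw0 : f w = fun=> 0.
  apply/funext => i.
  have := f_le 2^-1 w _ wB (halfB _ xB) _ i.
  rewrite (f_half _ _ xB es fx) => near_x.
  have := f_le 2^-1 w _ wB (halfB _ zB) _ i.
  rewrite (f_half _ _ zB (signsN _ es) fz) => near_z.
  have /near_x : forall i, `|w i - x i / 2| <= 2^-1.
    move=> j; have := cube_bounds z j zB.
    by rewrite /w ler_norml; lra.
  have /near_z : forall i, `|w i - z i / 2| <= 2^-1.
    move=> j; have := cube_bounds x j xB.
    by rewrite /w ler_norml; lra.
  by case: (es i) => ->; lra.
have w0 : w = fun=> 0 by apply: f_inj => //; rewrite contraction0.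
by apply/funext => i; have := congr1 (@^~ i) w0; rewrite /w => ?; lra.
Qed.

(** * The signed permutation of sign vectors *)

Lemma contraction_cone e x u : cube x -> signs e -> f x = e -> cube u ->
  (forall i, 0 <= u i * x i) -> forall i, 0 <= f u i * e i.
Proof.
move=> xB es fx uB ux i.
(* As [x] is a sign vector, agreement of signs puts [u] within 1 of it; being within 1 of [e i]
   fixes the sign of [f u i]. *)
have := f_le 1 u x uB xB (sub_signs_le _ _ uB (preimage_signs _ _ xB es fx) ux) i.
by rewrite fx; case: (es i) => ->; lra.
Qed.

(** Take [n] where the image of the basis vector of [m] is nonzero, and its sign [d] there. If
    [x m = 1], the cone lemma gives [e n = d]; the case [x m = -1] follows by passing to [- e].
    Pairing index and sign allows a single use of [choice]. *)
Lemma preimage_coordinate m : exists nt : I * R, (nt.2 = 1 \/ nt.2 = -1) /\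
  forall e x, cube x -> signs e -> f x = e -> x m = nt.2 * e nt.1.
Proof.
have dB : cube (axis R I m 1) by apply: axis_cube; rewrite normr1.
have [n fn0] : exists n, f (axis R I m 1) n != 0.
  apply: contrapT => /forallNP fm0.
  have : axis R I m 1 = fun=> 0.
    apply: f_inj => //; rewrite contraction0; apply/funext => n.
    by apply/eqP; apply: contrapT => /negP; exact: fm0.
  by move=> /(congr1 (@^~ m)); rewrite /axis eqxx => ?; lra.
pose d := sign_of R I (f (axis R I m 1)) n.
exists (n, d); split; first exact: sign_of_signs.
have pos e x : cube x -> signs e -> f x = e -> x m = 1 -> e n = d.
  move=> xB es fx xm.
  have := contraction_cone _ _ _ xB es fx dB _ n.
  have h j : 0 <= axis R I m 1 j * x j.
    by rewrite /axis; have [->|_] := eqVneq j m; rewrite ?xm; lra.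
  move=> /(_ h); rewrite /d.
  by case: (sign_ofP (f (axis R I m 1)) n) => -[? ->];
    case: (es n) => -> // => ?; lra.
move=> e x xB es fx /=.
have [xm|xm] := preimage_signs _ _ xB es fx m.
  rewrite -(pos e x)// xm; by case: (es n) => ->; lra.
have [z zB fz] := f_surj _ (signs_cube _ (signsN _ es)).
have zx := preimage_signsN _ _ _ xB zB es fx fz.
have := pos _ _ zB (signsN _ es) fz; rewrite zx xm opprK => /(_ erefl) <-.
by case: (es n) => ->; lra.
Qed.


Definition coordinate_from (m n : I) (th : R) : Prop :=
  (th = 1 \/ th = -1) /\
  forall e x, cube x -> signs e -> f x = e -> x m = th * e n.

(** The half-axis lies in the cone of the preimage of every [e] with [e n = 1]. The constant vector
    1 and its flip at [i != n] then give opposite signs to coordinate [i] of the image, which must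
    vanish. *)
Lemma contraction_axis m n th t : coordinate_from m n th -> 0 <= t <= 1 ->
  0 <= f (axis R I m (th * t)) n /\
  f (axis R I m (th * t)) = axis R I n (f (axis R I m (th * t)) n).
Proof.
move=> [th1 mn] t01; set u := axis R I m (th * t).
have uB : cube u.
  by apply: axis_cube; rewrite ler_norml; case: th1 => ->; lra.
have fu_ge0 e i : signs e -> e n = 1 -> 0 <= f u i * e i.
  move=> es en; have [x xB fx] := f_surj _ (signs_cube _ es).
  apply: (contraction_cone _ x) => // j; rewrite /u /axis.
  have [->|_] := eqVneq j m; last by rewrite mul0r.
  by rewrite (mn _ _ xB es fx) en; case: th1 => ->; lra.
have s1 : signs (fun=> 1) by move=> j; left.
have fu1 i := fu_ge0 _ i s1 erefl.
split; first by have := fu1 n; rewrite mulr1.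
apply/funext => i; rewrite /axis; have [->//|ni] := eqVneq i n.
have := fu_ge0 _ i (flip_signs _ i s1).
rewrite /flip eqxx [n == i]eq_sym (negbTE ni) => /(_ erefl).
by have := fu1 i; lra.
Qed.

(* If two coordinates had the same source, two half-axes would be mapped
   injectively into one. *)
Lemma coordinate_from_inj m m' n th th' :
  coordinate_from m n th -> coordinate_from m' n th' -> m = m'.
Proof.
wlog le_f : m m' th th' /
    f (axis R I m (th * 1)) n <= f (axis R I m' (th' * 1)) n.
  move=> wl mn m'n.
  case: (leP (f (axis R I m (th * 1)) n) (f (axis R I m' (th' * 1)) n)).
    by move=> h; exact: (wl _ _ _ _ h mn m'n).
  by move=> /ltW h; apply/esym; exact: (wl _ _ _ _ h m'n mn).
move=> mn m'n; apply: contrapT => /eqP mm'.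
have h1 : 0 <= (1 : R) <= 1 by lra.
have axB k d t : d = 1 \/ d = -1 -> 0 <= t <= 1 -> cube (axis R I k (d * t)).
  move=> d1 t01.
  by apply: axis_cube; rewrite ler_norml; case: d1 => ->; lra.
have th1 := mn.1; have th'1 := m'n.1.
pose g t := f (axis R I m' (th' * t)) n.
have gc : {within `[0, 1], continuous g}.
  apply: nonexpansive_within_continuous => s t s01 t01.
  rewrite /g ler_norml; apply: f_le; [exact: axB | exact: axB | move=> i].
  rewrite /axis; case: eqP => _; last by rewrite subrr normr0.
  by case: th'1 => ->; rewrite ?mul1r// !mulN1r -opprD normrN.
have g0 : g 0 = 0.
  rewrite /g mulr0 (_ : axis R I m' 0 = fun=> 0) ?contraction0//.
  by apply/funext => i; rewrite /axis; case: ifP.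
have [f_ge0 fm] := contraction_axis _ _ _ _ mn h1.
(* Along the half-axis of [m'], coordinate [n] of the image grows from 0 to at least its value at
   the end of the half-axis of [m], so that value is attained. *)
have [|t] := @IVT R g 0 1 (f (axis R I m (th * 1)) n) ler01 gc.
  by rewrite g0 /g ge_min f_ge0/= le_max le_f orbT.
rewrite in_itv /= => t01 gt.
have [_ fm'] := contraction_axis _ _ _ _ m'n t01.
have /(congr1 (@^~ m)) : axis R I m (th * 1) = axis R I m' (th' * t).
  by apply: f_inj; [exact: axB|exact: axB|rewrite fm fm' -gt].
rewrite /axis eqxx (negbTE mm').
by case: th1 => ->; lra.
Qed.

Lemma contraction_signed_permutation : exists (tau : I -> I) (th : I -> R),
  [/\ injective tau, forall n, exists m, tau m = n, signs th &
    forall e x, cube x -> signs e -> f x = e -> x = fun m => th m * e (tau m)].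
Proof.
have [nt ntP] := choice preimage_coordinate.
exists (fun m => (nt m).1), (fun m => (nt m).2); split.
- move=> m m' mm'.
  apply: (coordinate_from_inj m m' (nt m).1 (nt m).2 (nt m').2).
    exact: ntP.
  by rewrite mm'; exact: ntP.
(* If [tau] missed [n], two sign vectors differing only at [n] would have the same preimage. *)
- move=> n; apply: contrapT => /forallNP n_miss.
  have s1 : signs (fun=> 1) by move=> j; left.
  have s2 := flip_signs _ n s1.
  have [x xB fx] := f_surj _ (signs_cube _ s1).
  have [y yB fy] := f_surj _ (signs_cube _ s2).
  have xy : x = y.
    apply/funext => m; rewrite ((ntP m).2 _ _ xB s1 fx).
    rewrite ((ntP m).2 _ _ yB s2 fy) /flip.
    by case: eqP => // /n_miss.
  by have := congr1 (@^~ n) fx; rewrite xy fy /flip eqxx => {xy fx fy} ?; lra.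
- by move=> m; exact: (ntP m).1.
- by move=> e x xB es fx; apply/funext => m; exact: (ntP m).2.
Qed.

(** * Contractions fixing all sign vectors *)

Hypothesis f_signs : forall e, signs e -> f e = e.

Lemma fixed_signs_shrink u i : cube u ->
  0 <= f u i <= u i \/ u i <= f u i <= 0.
Proof.
move=> uB; pose e := sign_of R I u.
have es : signs e by exact: sign_of_signs.
have ue j : 0 <= u j * e j by rewrite /e; case: (sign_ofP u j) => -[? ->]; lra.
have fe := f_signs _ es.
have cone := contraction_cone _ _ _ (signs_cube _ es) es fe uB ue i.
have es' := flip_signs _ i es.
(* The sign vector farthest from u in coordinate i and nearest elsewhere. *)
have := f_le (1 + u i * e i) u _ uB (signs_cube _ es') _ i.
rewrite (f_signs _ es') /flip eqxx => upper.
have {upper}/upper : forall j, `|u j - (if j == i then - e j else e j)| <=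
    1 + u i * e i.
  move=> j; have uj := cube_bounds u j uB; have := ue i.
  have [->|_] := eqVneq j i; rewrite ler_norml.
    by case: (es i) => ->; lra.
  by have := ue j; case: (es j) => ->; lra.
move: cone (ue i); case: (es i) => ->; first by left; lra.
by right; lra.
Qed.

(** Such a [u] is within [1 - c] of its sign vector, which is fixed, so [f u] is too. *)
Lemma fixed_signs_inf c u : cube u -> (forall i, c <= `|u i|) ->
  forall i, c <= `|f u i|.
Proof.
move=> uB cu i; pose e := sign_of R I u.
have es : signs e by exact: sign_of_signs.
have := f_le (1 - c) u e uB (signs_cube _ es) _ i; rewrite (f_signs e es).
have ue j : `|u j - e j| <= 1 - c.
  have := cu j; have := cube_bounds u j uB; rewrite /e.
  by case: (sign_ofP u j) => -[uj ->];
    rewrite ?(ger0_norm uj) ?(ltr0_norm uj) ler_norml; lra.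
move=> /(_ ue).
have := ler_norm (f u i); have := ler_norm (- f u i); rewrite normrN.
by case: (es i) => ->; lra.
Qed.

End contraction.

Definition corner_cube (R : realType) (I : Type) (s : I -> R) (c : R) :
    set (I -> R) :=
  [set y | forall i, c <= s i * y i <= 1].

(** The interval [c, 1] has centre (1 + c) / 2 and half-width (1 - c) / 2. The sign [s i] stays
    outside, so [v i = 1] always gives the outer face. *)
Definition zoom (R : realType) (I : Type) (s : I -> R) (c : R) (v : I -> R) :
    I -> R :=
  fun i => s i * ((1 + c) / 2 + (1 - c) / 2 * v i).

Definition unzoom (R : realType) (I : Type) (s : I -> R) (c : R) (y : I -> R) :
    I -> R :=
  fun i => ((1 - c) / 2)^-1 * (s i * y i - (1 + c) / 2).

(** * Rescaling to a corner cube *)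

Section rescaling.
Context {R : realType} {I : eqType} {s : I -> R} {c : R}.
Hypotheses (s_signs : signs R I s) (c_gt0 : 0 < c) (c_lt1 : c < 1).
Implicit Types (u v y e : I -> R) (i : I).

Local Notation cube := (cube R I).
Local Notation signs := (signs R I).
Local Notation corner := (corner_cube R I s c).
Local Notation zoom := (zoom R I s c).
Local Notation unzoom := (unzoom R I s c).

Let r_gt0 : 0 < (1 - c) / 2.
Proof. by rewrite divr_gt0// subr_gt0. Qed.

Lemma corner_cubeW y : corner y -> cube y.
Proof.
move=> yK i; have := yK i; have := c_gt0.
by rewrite ler_norml; case: (s_signs i) => ->; lra.
Qed.

Lemma zoom_corner v : cube v -> corner (zoom v).
Proof.
move=> vB i; rewrite /zoom mulrA.
have -> : s i * s i = 1 by case: (s_signs i) => ->; lra.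
rewrite mul1r; have := cube_bounds v i vB => /andP[v1 v2].
have := ler_wpM2l (ltW r_gt0) v1; have := ler_wpM2l (ltW r_gt0) v2.
by lra.
Qed.

Lemma zoomK : cancel zoom unzoom.
Proof.
move=> v; apply/funext => i; rewrite /unzoom /zoom mulrA.
have -> : s i * s i = 1 by case: (s_signs i) => ->; lra.
by rewrite mul1r addrAC subrr add0r mulKf// gt_eqF.
Qed.

Lemma unzoomK : cancel unzoom zoom.
Proof.
move=> y; apply/funext => i; rewrite /unzoom /zoom mulVKf ?gt_eqF//.
rewrite addrC subrK mulrA.
have -> : s i * s i = 1 by case: (s_signs i) => ->; lra.
by rewrite mul1r.
Qed.

Lemma unzoom_cube y : corner y -> cube (unzoom y).
Proof.
move=> yK i; rewrite /unzoom normrM normfV (gtr0_norm r_gt0).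
by rewrite ler_pdivrMl// mulr1 ler_norml; have := yK i; lra.
Qed.

Lemma zoom_dist u v i : `|zoom u i - zoom v i| = (1 - c) / 2 * `|u i - v i|.
Proof.
rewrite /zoom -mulrBr normrM.
have -> : `|s i| = 1 by case: (s_signs i) => ->; rewrite ?normrN normr1.
by rewrite mul1r opprD addrACA subrr add0r -mulrBr normrM gtr0_norm.
Qed.

Context {f : (I -> R) -> I -> R}.
Hypotheses (f_contr : cube_contraction R I f)
  (f_signs : forall e, signs e -> f e = e).

Lemma corner_cube_stable y : corner y -> corner (f y).
Proof.
move=> yK i; have yB := corner_cubeW _ yK.
have y_inf j : c <= `|y j|.
  have := yK j; have := ler_norm (y j); have := ler_norm (- y j).
  by rewrite normrN; case: (s_signs j) => ->; lra.
have := fixed_signs_inf f_contr f_signs _ _ yB y_inf i.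
have := yK i; have := cube_bounds y i yB.
case: (fixed_signs_shrink f_contr f_signs _ i yB) => fyi.
  have fyi0 : 0 <= f y i by lra.
  by rewrite (ger0_norm fyi0); case: (s_signs i) => ->; lra.
have fyi0 : f y i <= 0 by lra.
by rewrite (ler0_norm fyi0); case: (s_signs i) => ->; lra.
Qed.

(** Signs are kept and moduli do not increase. This gives surjectivity of the restriction to the
    corner cube. *)
Lemma corner_cube_reflect y : cube y -> corner (f y) -> corner y.
Proof.
move=> yB fK i; have := c_gt0; have := fK i; have := cube_bounds y i yB.
case: (fixed_signs_shrink f_contr f_signs _ i yB) => fyi;
  by case: (s_signs i) => ->; lra.
Qed.

Definition rescaled v : I -> R := unzoom (f (zoom v)).

Lemma rescaled_zoom v : zoom (rescaled v) = f (zoom v).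
Proof. exact: unzoomK. Qed.

Lemma rescaled_contraction : cube_contraction R I rescaled.
Proof.
have [[fB fI fS] fN] := f_contr.
have zB v : cube v -> cube (zoom v) by move=> /zoom_corner/corner_cubeW.
split; first split.
- by move=> v vB; apply/unzoom_cube/corner_cube_stable/zoom_corner.
- move=> u v /set_mem uB /set_mem vB uv; apply: (can_inj zoomK).
  apply: fI; [exact/mem_set/zB|exact/mem_set/zB|].
  by rewrite -!rescaled_zoom uv.
- move=> y yB; have yK := zoom_corner _ yB.
  have [u uB fu] := fS _ (corner_cubeW _ yK).
  have uK : corner u by apply: corner_cube_reflect => //; rewrite fu.
  exists (unzoom u); first exact: unzoom_cube.
  by rewrite /rescaled unzoomK fu zoomK.
- move=> d u v uB vB uv i; rewrite -(ler_pM2l r_gt0) -zoom_dist.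
  rewrite !rescaled_zoom; apply: fN; [exact: zB|exact: zB|move=> j].
  by rewrite zoom_dist ler_pM2l.
Qed.

(** Where [e i = 1], the image lies on the outer face; since moduli do not increase, so does its
    preimage. Where [e i = -1], the same applies to the preimage of [- e], which is the opposite of
    that of [e]. *)
Lemma rescaled_signs e : signs e -> rescaled e = e.
Proof.
have contr := rescaled_contraction.
have [[_ _ rS] _] := contr.
have pos x e' i : cube x -> rescaled x = e' -> e' i = 1 -> x i = 1.
  move=> xB rx e1; have xK := zoom_corner _ xB.
  have fx : f (zoom x) i = s i * ((1 + c) / 2 + (1 - c) / 2).
    by rewrite -rescaled_zoom rx /zoom e1 mulr1.
  have := fixed_signs_shrink f_contr f_signs _ i (corner_cubeW _ xK).
  rewrite fx; have := xK i.
  have : (1 - c) / 2 * x i = (1 - c) / 2 -> x i = 1.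
    by move=> xr; apply: (mulfI (lt0r_neq0 r_gt0)); rewrite mulr1.
  rewrite /zoom; have := c_gt0.
  by case: (s_signs i) => -> ? xr ? ?; apply: xr; lra.
move=> es; have [x xB rx] := rS _ (signs_cube _ es).
have [z zB rz] := rS _ (signs_cube _ (signsN _ es)).
have zx := preimage_signsN contr _ _ _ xB zB es rx rz.
suff xe : x = e by rewrite -{1}xe.
apply/funext => i; have [ei|ei] := es i.
  by rewrite ei; exact: pos rx ei.
have := pos _ _ i zB rz; rewrite ei opprK zx => /(_ erefl) <-.
by rewrite opprK.
Qed.

End rescaling.

(** * Rigidity of the cube *)

Section rigidity.
Context {R : realType} {I : eqType}.

(** The map stays quantified in the induction because the induction hypothesis is applied to the
    rescaled map. *)
Lemma fixed_signs_dist k : forall f : (I -> R) -> I -> R,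
  cube_contraction R I f -> (forall e, signs R I e -> f e = e) ->
  forall u i, cube R I u -> `|f u i - u i| <= 2 / 2 ^+ k.
Proof.
elim: k => [|k IHk] f fC fs u i uB.
  have := cube_bounds u i uB; rewrite expr0 divr1 ler_norml.
  by case: (fixed_signs_shrink fC fs _ i uB); lra.
have [_ fN] := fC.
pose s := sign_of R I u; have ss : signs R I s by exact: sign_of_signs.
suff close c : 0 < c -> c < 1 -> `|f u i - u i| <= 2 / 2 ^+ k.+1 + 2 * c.
  apply/ler_addgt0Pr => e e0.
  pose c := Num.min (e / 2) (2^-1 : R).
  have c0 : 0 < c by rewrite lt_min; lra.
  have c1 : c < 1 by rewrite gt_min; apply/orP; right; lra.
  have ce : 2 * c <= e.
    have : c <= e / 2 by rewrite ge_min lexx.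
    by lra.
  by apply: le_trans (close _ c0 c1) _; rewrite lerD2l.
move=> c0 c1.
(* Raising the small moduli to [c] moves [u] into a corner cube at cost at most [c]; this cost is
   paid once for [u] and once for [f u]. *)
pose w : I -> R := fun j => s j * Num.max c `|u j|.
have ssj j : s j * s j = 1 by case: (ss j) => ->; lra.
have wK : corner_cube R I s c w.
  move=> j; rewrite /w mulrA ssj mul1r le_max lexx /= ge_max (ltW c1).
  exact: uB.
have wB := corner_cubeW ss c0 _ wK.
have uw j : `|u j - w j| <= c.
  rewrite /w /s; have := cube_bounds u j uB.
  case: (sign_ofP u j) => -[uj ->];
    rewrite ?(ger0_norm uj) ?(ltr0_norm uj) ler_norml.
    by case: (lerP c (u j)); lra.
  by case: (lerP c (- u j)); lra.
have := IHk _ (rescaled_contraction ss c0 c1 fC fs)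
  (rescaled_signs ss c0 c1 fC fs) _ i (unzoom_cube c1 _ wK).
rewrite -(ler_pM2l (_ : 0 < (1 - c) / 2)); last lra.
rewrite -(zoom_dist ss c1) (rescaled_zoom ss c1) (unzoomK ss c1) => fw.
have := fN _ _ _ uB wB uw i; have := uw i; move: fw.
have q0 : 0 <= 2 / 2 ^+ k :> R by rewrite divr_ge0// exprn_ge0.
have -> : 2 / 2 ^+ k.+1 = 2^-1 * (2 / 2 ^+ k) :> R.
  by rewrite exprS invfM mulrCA.
move: q0; set q := 2 / 2 ^+ k => q0.
have : (1 - c) / 2 * q <= 2^-1 * q by rewrite ler_wpM2r//; lra.
move: ((1 - c) / 2 * q) => q'.
by rewrite !ler_norml; lra.
Qed.

Lemma fixed_signs_id (f : (I -> R) -> I -> R) : cube_contraction R I f ->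
  (forall e, signs R I e -> f e = e) -> forall u, cube R I u -> f u = u.
Proof.
move=> fC fs u uB; apply/funext => i; apply/eqP.
rewrite -subr_eq0 -normr_le0; apply/ler_addgt0Pr => e e0; rewrite add0r.
(* Choose [k] with 1 / 2^k < e / 2. *)
have [k _ /(_ k (leqnn k)) /= ek] :=
  near_infty_natSinv_expn_lt (PosNum (divr_gt0 e0 (ltr0Sn R 1))).
apply: le_trans (fixed_signs_dist k _ fC fs u i uB) _.
by move: ek; rewrite mul1r; move: (2 ^+ k)^-1 => ?; lra.
Qed.

(** With [T] the signed permutation, [f \o T] is the identity on the cube, so [T] inverts [f] there,
    and permuting coordinates and changing signs preserves uniform bounds. *)
Lemma cube_plastic (f : (I -> R) -> I -> R) : cube_contraction R I f ->
  forall d u v, cube R I u -> cube R I v ->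
  (forall i, `|f u i - f v i| <= d) -> forall i, `|u i - v i| <= d.
Proof.
move=> fC; have [[fB fI fS] fN] := fC.
have [tau [th [tau_inj tau_surj th_signs f_pre]]] :=
  contraction_signed_permutation fC.
pose T (y : I -> R) : I -> R := fun m => th m * y (tau m).
have th1 m : `|th m| = 1 by case: (th_signs m) => ->; rewrite ?normrN normr1.
have thth m : th m * th m = 1 by case: (th_signs m) => ->; lra.
have TB u : cube R I u -> cube R I (T u).
  by move=> uB m; rewrite /T normrM th1 mul1r.
have T_dist u v m : `|T u m - T v m| = `|u (tau m) - v (tau m)|.
  by rewrite /T -mulrBr normrM th1 mul1r.
have [sg sgP] := choice tau_surj.
pose T' (y : I -> R) : I -> R := fun n => th (sg n) * y (sg n).
have T'B u : cube R I u -> cube R I (T' u).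
  by move=> uB m; rewrite /T' normrM th1 mul1r.
have T'K y : T (T' y) = y.
  apply/funext => m; rewrite /T /T'.
  by rewrite (tau_inj (sg (tau m)) m) ?sgP// mulrA thth mul1r.
have TK y : T' (T y) = y.
  by apply/funext => n; rewrite /T /T' sgP mulrA thth mul1r.
have fT_id : forall u, cube R I u -> (f \o T) u = u.
  apply: fixed_signs_id; last first.
    move=> e es; have [x xB fx] := fS _ (signs_cube _ es).
    by rewrite /= -[T e](f_pre e x).
  split; first split.
  - by move=> u uB; apply/fB/TB.
  - move=> u v /set_mem uB /set_mem vB uv; apply: (can_inj TK).
    by apply: fI => //; apply/mem_set/TB.
  - move=> y /fS[x xB fx]; exists (T' x); first exact: T'B.
    by rewrite /= T'K.
  - move=> d u v uB vB uv; apply: fN; [exact: TB|exact: TB|].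
    by move=> m; rewrite T_dist.
move=> d u v uB vB fuv m.
have fT' y : cube R I y -> T (f y) = y.
  by move=> yB; rewrite -{1}(T'K y) [f _](fT_id _ (T'B _ yB)) T'K.
by rewrite -(fT' u uB) -(fT' v vB) T_dist.
Qed.

End rigidity.

(** * The unit ball of l_infinity *)

Section linfty_ball.
Context {R : realType}.

Lemma linfty_norm_leP (x : linfty R) (d : R) :
  `|x| <= d <-> forall n, `|x n| <= d.
Proof.
split=> [xd n|]; first exact: le_trans (le_sup_norm x n) xd.
exact: sup_norm_le.
Qed.

Lemma cube_bounded (u : nat -> R) : cube R nat u -> u \in @bounded_seq R.
Proof. by move=> uB; apply/bounded_seqP; exists 1. Qed.

Lemma cube_in_ball u (uB : cube R nat u) :
  Linfty (cube_bounded u uB) \in linfty_unit_ball R.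
Proof. by apply/mem_set/linfty_norm_leP. Qed.

Definition ball_of_cube u (uB : cube R nat u) : linfty_unit_ball R :=
  SigSub (cube_in_ball u uB).

Lemma ball_cube (x : linfty_unit_ball R) : cube R nat (\val x : linfty R).
Proof. by apply/linfty_norm_leP; exact: set_mem (valP x). Qed.

Lemma ball_ext (x y : linfty_unit_ball R) :
  (\val x : linfty R) = (\val y : linfty R) :> (nat -> R) -> x = y.
Proof. by move=> xy; apply/val_inj/val_inj. Qed.

Lemma linfty_ball_rigid (F : linfty_unit_ball R -> linfty_unit_ball R) :
    bijective F ->
    (forall x y, `|\val (F x) - \val (F y)| <= `|\val x - \val y|) ->
  forall x y, `|\val (F x) - \val (F y)| = `|\val x - \val y|.
Proof.
move=> [G FK GK] F_le.
(* Off the cube [f] takes a default value; [cube_contraction] constrains it only on the cube. *)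
pose f (u : nat -> R) : nat -> R :=
  if pselect (cube R nat u) is left uB then \val (F (ball_of_cube u uB)) : linfty R
  else u.
have fE (x : linfty_unit_ball R) : f (\val x : linfty R) = (\val (F x) : linfty R).
  rewrite /f; case: pselect => [xB|/(_ (ball_cube x))//].
  by congr (linfty_val (\val (F _))); apply: ball_ext.
have to_ball u : cube R nat u -> exists x : linfty_unit_ball R,
    u = (\val x : linfty R).
  by move=> uB; exists (ball_of_cube u uB).
have fC : cube_contraction R nat f.
  split; first split.
  - by move=> _ /to_ball[x ->]; rewrite fE; exact: ball_cube.
  - move=> _ _ /set_mem/to_ball[x ->] /set_mem/to_ball[y ->].
    by rewrite !fE => /ball_ext/(can_inj FK)->.
  - move=> _ /to_ball[y ->]; exists (\val (G y) : linfty R).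
      exact: ball_cube.
    by rewrite fE GK.
  - move=> d _ _ /to_ball[x ->] /to_ball[y ->] xy n; rewrite !fE.
    have /linfty_norm_leP xyd : forall n, `|(\val x - \val y : linfty R) n| <= d.
      exact: xy.
    exact: (linfty_norm_leP _ _).1 (le_trans (F_le x y) xyd) n.
move=> x y; apply/eqP; rewrite eq_le F_le/=.
apply/linfty_norm_leP => n.
apply: (cube_plastic f fC _ _ _ (ball_cube x) (ball_cube y)) => m.
by rewrite !fE; exact: (le_sup_norm (\val (F x) - \val (F y))).
Qed.

End linfty_ball.

Theorem theorem1 (R : realType) :
  (forall F : linfty_unit_ball R -> linfty_unit_ball R,
      bijective F ->
      (forall x y : linfty_unit_ball R,
         `|\val (F x) - \val (F y)| <= `|\val x - \val y|) ->
      forall x y : linfty_unit_ball R,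
        `|\val (F x) - \val (F y)| = `|\val x - \val y|)
  /\ plastic (linfty_unit_ball R).
Proof.
(* The distance on the ball unfolds to the norm of the difference, so both conjuncts are the same
   statement up to conversion. *)
by split; [exact: linfty_ball_rigid | exact: linfty_ball_rigid].
Qed.
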